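(* Let $u,v\in\mathbb{R}^2$ be linearly independent unit vectors with angle $2\beta\in(0,\pi)$ between them, let $c_u\neq0$, $c_v>0$ be real constants, and let $\beta_1$ and $\widetilde\alpha=(\widetilde\alpha_x,\widetilde\alpha_y)$ be the associated angle and unit vector (defined in the context). Let $T_wf$ be the weighted V-line transform of $f\in L^1(\mathbb{R}^2)$ with weights $c_u,c_v$, and let $$F(x,y)=\frac{\sin\beta_1}{c_v}\int_0^\infty (T_wf)(x+\widetilde\alpha_xt,\,y+\widetilde\alpha_yt)\,dt .$$ If $F$ is constant on some set $S\subset\mathbb{R}^2$ with non-empty interior $S^0$, then $f=0$ in $S^0$ (almost everywhere).
   Context: For $(x,y)\in\mathbb{R}^2$ and a unit vector $w$, $R_w(x,y)=\{(x,y)+tw:t\ge0\}$. The weighted V-line transform is $(T_wf)(x,y)=c_v\int_{R_v(x,y)}f\,dl+c_u\int_{R_u(x,y)}f\,dl$, where $dl$ is the one-dimensional Lebesgue measure; for $f\in L^1(\mathbb{R}^2)$ it is defined for almost every $(x,y)$. The angles $\beta_1\in(0,\pi)$ and $\beta_2$ with $|\beta_2|\in(0,\pi)$ are uniquely determined by $\beta_1+\beta_2=2\beta$ and $\frac{\sin\beta_1}{\sin\beta_2}=\frac{c_v}{c_u}$, and $\widetilde\alpha=\frac{c_uv+c_vu}{\|c_uv+c_vu\|}$. *)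

(* Defs.v *)
From HB Require Import structures.
From mathcomp Require Import all_boot all_order all_algebra.
From mathcomp Require Import all_classical all_reals all_analysis.

Set Implicit Arguments.
Unset Strict Implicit.
Unset Printing Implicit Defensive.

Import Order.TTheory GRing.Theory Num.Theory.
Import numFieldNormedType.Exports.

Local Open Scope classical_set_scope.
Local Open Scope ring_scope.

Section VLine.
Context {R : realType}.
Implicit Types (p u v w : R * R) (f : R * R -> R) (cu cv : R).

Definition leb2 :
    {measure set (measurableTypeR R * measurableTypeR R) -> \bar R} :=
  (lebesgue_measure \x lebesgue_measure)%E.

Definition dot u v : R := u.1 * v.1 + u.2 * v.2.

(* The library norm on [R * R] is the sup norm, hence the Euclidean one here. *)
Definition enorm u : R := Num.sqrt (dot u u).

(* Unoriented angle, in [0, pi]. *)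
Definition angle u v : R := acos (dot u v / (enorm u * enorm v)).

(* Integral of [f] over the ray from [p] in direction [w]: for a unit vector
   [w] the parameter [t] is arc length. Where [f] is not integrable on the ray
   the value is a dummy one. *)
Definition ray_integral w f p : R :=
  \int[lebesgue_measure]_(t in `[0, +oo[) f (p + t *: w).

Definition vline_transform cu cv u v f p : R :=
  cv * ray_integral v f p + cu * ray_integral u f p.

Definition alpha_tilde cu cv u v : R * R :=
  (enorm (cu *: v + cv *: u))^-1 *: (cu *: v + cv *: u).

(* The outer integrand is defined for almost every [t], and is integrable, for
   every [p] as soon as [f] is integrable on the plane and [u], [v] are linearly
   independent with nonzero weights: [alpha_tilde] is then parallel to neither
   [u] nor [v], so Fubini applies on the cones that it spans with them. *)
Definition vline_antiderivative cu cv beta1 u v f p : R :=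
  sin beta1 / cv *
  ray_integral (alpha_tilde cu cv u v) (vline_transform cu cv u v f) p.

End VLine.

(* Main.v *)
Require Import Defs.
From HB Require Import structures.
From mathcomp Require Import all_boot all_order all_algebra.
From mathcomp Require Import all_classical all_reals all_analysis.
From mathcomp Require Import measurable_realfun ring.

Import Order.TTheory GRing.Theory Num.Theory.
Import numFieldNormedType.Exports.

Local Open Scope classical_set_scope.
Local Open Scope ring_scope.

(** Write points in the basis [(u, v)] and put [g (x, y) := f (x u + y v)].
    Integrating [f] first along [v] (or [u]) and then along the direction
    [a := alpha_tilde] is, by Fubini, a double integral over the cone spanned by
    [a] and [v] (or [u]). Since [a] is the unit vector along [cu v + cv u], the
    Jacobians of the two parametrizations are proportional to [cv] and [|cu|],
    which cancels the weights up to the sign of [cu]. So the antiderivative at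
    [x0 u + y0 v] is a nonzero multiple of

      (integral over the cone of [a] and [v])
        + (sign of [cu]) (integral over the cone of [a] and [u]).

    If [cu > 0] the ray along [a] cuts the cone of [u] and [v] into these two
    pieces; if [cu < 0] it lies outside, and the cone of [u] and [v] is the
    difference of the two. In both cases the antiderivative is a nonzero constant
    times the integral of [g] over the quadrant [x >= x0, y >= y0]: this is
    [vline_antiderivativeE].

    When it is constant on [S], inclusion-exclusion on the four corners
    ([Rintegral_box]) makes the integral of [g] vanish on every half-open box
    whose closure is sent into [S]. Cut off to such a box, [g] has zero integral
    on all quadrants; these form a pi-system that generates the Borel sets of the
    plane, so the positive and negative parts of the cut-off have the same
    density measure and it vanishes almost everywhere
    ([quadrant_Rintegral0_ae0]). Countably many boxes with rational corners cover
    the interior of the preimage of [S], and null sets travel back to the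
    original coordinates because linear bijections multiply areas by a constant
    ([scales_area_affine]). *)

Set Implicit Arguments.
Unset Strict Implicit.

(** * Affine maps multiply areas by a constant *)

Lemma lebesgue_measure_affine (R : realType) (k c : R) (X : set (measurableTypeR R)) :
  k != 0 -> measurable X ->
  lebesgue_measure ((fun t => k * t + c) @^-1` X) =
    (`|k|^-1%:E * lebesgue_measure X)%E.
Proof.
move=> k0 mX.
pose T : measurableTypeR R -> measurableTypeR R := fun t => k * t + c.
have mT : measurable_fun setT T.
  by apply: measurable_funD => //; apply: measurable_funM.
have k1 : 0 < `|k| by rewrite normr_gt0.
pose r : {nonneg R} := NngNum (ltW k1).
suff E : pushforward (mscale r lebesgue_measure) T X = lebesgue_measure X.
  rewrite -E /pushforward/= /mscale/= muleA -EFinM mulVf ?mul1e//.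
  by rewrite gt_eqF.
apply/esym/lebesgue_measure_unique => //= _ [[a b]] /= _ <-.
rewrite /mscale /pushforward /= /T.
have [kp|kn] : 0 < k \/ k < 0 by move: k0; rewrite neq_lt => /orP[]; tauto.
- have -> : (fun t => k * t + c) @^-1` `]a, b] = `](a - c) / k, (b - c) / k]%classic.
    apply/seteqP; split => t /=; rewrite !in_itv/= ltr_pdivrMr// ler_pdivlMr//
      ltrBlDr lerBrDr mulrC//.
  rewrite !lebesgue_measure_itv/= !lte_fin ltr_pdivrMr// divfK// ltrBlDr subrK.
  case: ifP => _; rewrite ?mule0// gtr0_norm// -!EFinB -EFinM; congr _%:E.
  by field.
- have -> : (fun t => k * t + c) @^-1` `]a, b] = `[(b - c) / k, (a - c) / k[%classic.
    apply/seteqP; split => t /=; rewrite !in_itv/= ler_ndivrMr// ltr_ndivlMr//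
      lerBrDr ltrBlDr mulrC andbC//.
  rewrite !lebesgue_measure_itv/= !lte_fin ltr_ndivlMr// divfK// ltrBlDr subrK.
  case: ifP => _; rewrite ?mule0// ltr0_norm// -!EFinB -EFinM; congr _%:E.
  by field.
Qed.

Section AreaScaling.
Context {R : realType}.
Notation plane := (measurableTypeR R * measurableTypeR R)%type.
Implicit Types (T : R * R -> R * R) (c : R).

(** Only preimages are used, so that a map need not be shown to be a bijection:
    for an affine bijection, [c] is the inverse of [|det|]. *)
Definition scales_area T c :=
  [/\ 0 < c, measurable_fun setT (T : plane -> plane) &
   forall X : set plane, measurable X -> leb2 (T @^-1` X) = (c%:E * leb2 X)%E].

Lemma scales_area_comp T1 T2 c1 c2 : scales_area T1 c1 -> scales_area T2 c2 ->
  scales_area (T1 \o T2) (c1 * c2).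
Proof.
move=> [c10 m1 s1] [c20 m2 s2]; split.
- exact: mulr_gt0.
- exact: (measurableT_comp (m1 : measurable_fun _ (T1 : plane -> plane)) m2).
move=> X mX; rewrite comp_preimage s2; last first.
  by rewrite -[X in measurable X]setTI; exact: m1.
by rewrite s1// muleA -EFinM mulrC.
Qed.

Lemma scales_area_swap : scales_area (fun z => (z.2, z.1)) 1.
Proof.
have ms : measurable_fun setT ((fun z => (z.2, z.1)) : plane -> plane).
  exact: measurable_swap.
split => // X mX; rewrite mul1e.
suff E : (lebesgue_measure \x lebesgue_measure)%E X =
    pushforward leb2 ((fun z => (z.2, z.1)) : plane -> plane) X by exact/esym.
apply: product_measure_unique => //= A B mA mB.
rewrite /pushforward/= [LHS](_ : _ = leb2 (B `*` A)).
  by rewrite muleC; exact: product_measure1E.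
by congr (leb2 _); apply/seteqP; split => -[x y] /= [].
Qed.

(** The vertical sections of the preimage are affine preimages of those of the
    set, so the planar statement is the one-dimensional one under the integral
    that defines the product measure. *)
Lemma scales_area_shear (k l c : R) : k != 0 ->
  scales_area (fun z => (z.1, k * z.2 + l * z.1 + c)) `|k|^-1.
Proof.
move=> k0.
have mE : measurable_fun setT
    ((fun z => (z.1, k * z.2 + l * z.1 + c)) : plane -> plane).
  apply: measurable_fun_pair; first exact: measurable_fst.
  by apply: measurable_funD => //; apply: measurable_funD;
    apply: measurable_funM.
have k1 : 0 < `|k|^-1 by rewrite invr_gt0 normr_gt0.
split => // X mX.
rewrite /leb2/= /product_measure1.
transitivity (\int[lebesgue_measure]_x
    (`|k|^-1%:E * (lebesgue_measure \o xsection X) x))%E.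
  apply: eq_integral => x _ /=.
  rewrite -(lebesgue_measure_affine (l * x + c) k0)//; last first.
    exact: measurable_xsection.
  congr (lebesgue_measure _); apply/seteqP; split => y /=;
    by rewrite /xsection/= !inE/= addrA.
by rewrite ge0_integralZl//; exact: measurable_fun_xsection.
Qed.

(** An affine bijection with [a != 0] factors as a shear, conjugated by the swap
    of coordinates, followed by a shear; swapping the coordinates first reduces
    the case [a = 0], where [b != 0], to that one. *)
Lemma scales_area_affine (x0 y0 a b c d : R) : a * d - b * c != 0 ->
  scales_area (fun z => (x0 + a * z.1 + b * z.2, y0 + c * z.1 + d * z.2))
    `|a * d - b * c|^-1.
Proof.
have main (a' b' c' d' : R) : a' != 0 -> a' * d' - b' * c' != 0 ->
    scales_area (fun z => (x0 + a' * z.1 + b' * z.2, y0 + c' * z.1 + d' * z.2))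
    `|a' * d' - b' * c'|^-1.
  move=> a0 D0.
  have k0 : (a' * d' - b' * c') / a' != 0 by rewrite mulf_neq0 ?invr_neq0.
  have := scales_area_comp (scales_area_shear (c' / a') (y0 - c' / a' * x0) k0)
    (scales_area_comp scales_area_swap
       (scales_area_comp (scales_area_shear b' x0 a0) scales_area_swap)).
  congr scales_area.
    apply/funext => -[x y] /=; congr pair; first by ring.
    by field.
  rewrite mul1r mulr1 -invfM -normrM; congr (_^-1); congr `|_|.
  by field.
move=> D0; have [a0|a0] := eqVneq a 0; last exact: main.
have b0 : b != 0.
  by apply: contraNneq D0 => ->; rewrite a0 !mul0r subrr.
have D1 : b * c - a * d != 0 by rewrite -opprB oppr_eq0.
have := scales_area_comp (main b a d c b0 D1) scales_area_swap.
congr scales_area; last by rewrite mulr1 distrC.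
by apply/funext => -[x y] /=; congr pair; ring.
Qed.

End AreaScaling.

(** * Change of variables and iterated integrals *)

Section ChangeOfVariables.
Context {R : realType}.
Notation plane := (measurableTypeR R * measurableTypeR R)%type.
Variables (T : R * R -> R * R) (c : R).
Hypothesis sT : scales_area T c.

Let c0 : 0 < c. Proof. by case: sT. Qed.

Let mT : measurable_fun setT (T : plane -> plane). Proof. by case: sT. Qed.

Lemma scales_area_measurable (D : set plane) :
  measurable D -> measurable (T @^-1` D : set plane).
Proof. by move=> mD; rewrite -[X in measurable X]setTI; exact: mT. Qed.

Lemma scales_area_ge0_integral (D : set plane) (h : plane -> \bar R) :
  measurable D -> measurable_fun setT h -> (forall z, (0 <= h z)%E) ->
  (\int[leb2]_(z in T @^-1` D) h (T z) = c%:E * \int[leb2]_(z in D) h z)%E.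
Proof.
move=> mD mh h0.
pose r : {nonneg R} := NngNum (ltW c0).
have mhD : measurable_fun D h by exact: measurable_funS mh.
rewrite -[RHS](@ge0_integral_mscale _ _ _ leb2 D mD r)//.
rewrite -[LHS](ge0_integral_pushforward mT leb2 mD mhD)//.
apply: eq_measure_integral => // A mA _.
by rewrite /pushforward /mscale/=; case: sT => _ _; exact.
Qed.

Lemma scales_area_integrable (D : set plane) (h : R * R -> R) :
  measurable D -> leb2.-integrable setT (EFin \o h) ->
  leb2.-integrable (T @^-1` D) (EFin \o (h \o T)).
Proof.
move=> mD /integrableP[mh hoo].
have mhT : measurable_fun setT (EFin \o (h \o T) : plane -> \bar R).
  exact: (measurableT_comp mh mT).
apply: (@integrableS _ _ _ _ setT) => //; first exact: scales_area_measurable.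
apply/integrableP; split => //.
rewrite -[setT](preimage_setT T).
rewrite (@scales_area_ge0_integral setT (fun z => `|(h z)%:E|)%E)//.
- by apply: lte_mul_pinfty => //; rewrite lee_fin ltW.
- exact: measurableT_comp.
Qed.

Lemma scales_area_Rintegral (D : set plane) (h : R * R -> R) :
  measurable D -> leb2.-integrable setT (EFin \o h) ->
  Rintegral leb2 (T @^-1` D) (h \o T) = c * Rintegral leb2 D h.
Proof.
move=> mD ih; have mh := measurable_int _ ih.
have ihD : leb2.-integrable D (EFin \o h) by exact: integrableS ih.
rewrite /Rintegral integralE.
under eq_integral do rewrite (funepos_comp (EFin \o h) T)/=.
under [X in (_ - X)%E]eq_integral do rewrite (funeneg_comp (EFin \o h) T)/=.
rewrite !scales_area_ge0_integral//; last 2 first.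
- exact: measurable_funeneg.
- exact: measurable_funepos.
rewrite -[c in RHS]/(fine c%:E) -fineM//; last exact: integrable_fin_num.
congr fine; rewrite [in RHS]integralE [RHS]muleBr//.
rewrite fin_num_adde_defl// fin_numN.
exact: (integrable_fin_num _ (integrable_funeneg _ ihD)).
Qed.

End ChangeOfVariables.

(** Fubini for real-valued iterated integrals. The inner integral takes a dummy
    value where the section is not integrable; this happens for almost no [x],
    hence the outer integral does not see it. *)
Lemma Rintegral_setX (R : realType) (h : R * R -> R)
    (A B : set (measurableTypeR R)) :
  measurable A -> measurable B -> leb2.-integrable setT (EFin \o h) ->
  lebesgue_measure.-integrable A
    (EFin \o (fun x => \int[lebesgue_measure]_(y in B) h (x, y))) /\
  \int[lebesgue_measure]_(x in A) \int[lebesgue_measure]_(y in B) h (x, y) =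
    Rintegral leb2 (A `*` B) h.
Proof.
move=> mA mB ih.
have mAB : measurable (A `*` B) by exact: measurableX.
pose K := (EFin \o h) \_ (A `*` B).
have iK : leb2.-integrable setT K.
  apply/(integrable_mkcond _ mAB).
  by apply: (integrableS measurableT mAB _ ih).
pose G (x : measurableTypeR R) := (\int[lebesgue_measure]_(y in B) (h (x, y))%:E)%E.
have GK : fubini_F lebesgue_measure K = G \_ A.
  apply/funext => x; rewrite /fubini_F /patch; case: ifPn => xA.
    rewrite /G [RHS]integral_mkcond; apply: eq_integral => y _.
    by rewrite /K /patch in_setX/= xA.
  rewrite integral0_eq// => y _.
  by rewrite /K /patch in_setX/= (negbTE xA).
have iG : lebesgue_measure.-integrable A G.
  by apply/integrable_mkcond => //; rewrite -GK; exact: integrable_fubini_F.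
have mG := measurable_int _ iG.
have mfG : measurable_fun A (EFin \o (fine \o G)).
  exact/measurable_EFinP/measurableT_comp.
have fG : ae_eq lebesgue_measure A (EFin \o (fine \o G)) G.
  by apply: filterS (integrable_ae mA iG) => x /[apply] /= /fineK.
split.
  apply: (le_integrable mA mfG _ iG) => x _ /=.
  rewrite /comp -/(G x); case: (G x) => [r| |] //=; by rewrite normr0 leey.
rewrite /Rintegral -/G; congr fine.
rewrite [LHS](ae_eq_integral G _ mA mfG mG fG).
rewrite [RHS]integral_mkcond -/K [LHS]integral_mkcond -GK.
exact: (integral12_prod_meas1 iK).
Qed.

(** * Integrals over quadrants determine a function *)

Section Density.
Context d (T : measurableType d) (R : realType).
Variables (mu : {measure set T -> \bar R}) (f : T -> \bar R).
Hypotheses (mf : measurable_fun setT f) (f0 : forall x, (0 <= f x)%E).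
Local Open Scope ereal_scope.

Definition density (A : set T) : \bar R := \int[mu]_(x in A) f x.

Let density0 : density set0 = 0. Proof. exact: integral_set0. Qed.

Let density_ge0 A : 0 <= density A. Proof. exact: integral_ge0. Qed.

Let density_sigma_additive : semi_sigma_additive density.
Proof. exact: semi_sigma_additive_nng_induced. Qed.

HB.instance Definition _ := isMeasure.Build _ _ _ density
  density0 density_ge0 density_sigma_additive.

End Density.

Section Quadrants.
Context {R : realType}.
Notation plane := (measurableTypeR R * measurableTypeR R)%type.

Definition quadrant (x y : R) : set plane := `[x, +oo[ `*` `[y, +oo[.

Lemma measurable_quadrant x y : measurable (quadrant x y).
Proof. by apply: measurableX; exact: measurable_itv. Qed.

Lemma quadrantI x1 y1 x2 y2 :
  quadrant x1 y1 `&` quadrant x2 y2 = quadrant (Num.max x1 x2) (Num.max y1 y2).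
Proof.
apply/seteqP; split => -[x y]; rewrite /quadrant/= !in_itv/= !andbT !ge_max.
  by move=> [[-> ->] [-> ->]].
by move=> [/andP[-> ->] /andP[-> ->]].
Qed.

Let Q : set (set plane) := [set X | exists x y, X = quadrant x y].

Lemma bigcup_quadrantN : \bigcup_k quadrant (- k%:R) (- k%:R) = setT.
Proof.
rewrite -subTset => -[x y] _.
pose n := (Num.truncn (Num.max `|x| `|y|)).+1.
have : Num.max `|x| `|y| < n%:R by exact: truncnS_gt.
rewrite gt_max !ltr_norml => /andP[/andP[? _] /andP[? _]].
by exists n => //; rewrite /quadrant/= !in_itv/= !andbT; split; exact: ltW.
Qed.

(** [fst @^-1` B] and [snd @^-1` B] generate the product sigma-algebra, and it
    is enough to take rays for [B]; the strip over a ray is an increasing union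
    of quadrants. *)
Lemma measurable_quadrantsE : @measurable _ plane = <<s Q >>.
Proof.
apply/seteqP; split; last first.
  apply: smallest_sub; first exact: sigma_algebra_measurable.
  by move=> _ [x [y ->]]; exact: measurable_quadrant.
have sQ : sigma_algebra setT <<s Q >> by exact: smallest_sigma_algebra.
have ray (B : set (measurableTypeR R)) :
    measurable B -> <<s @RGenCInfty.G R >> B.
  by move=> mB; have := mB; rewrite [X in X _](@RGenCInfty.measurableE R).
apply: smallest_sub => //; rewrite subUset; split => _ [B /ray mB <-];
  rewrite setTI.
- suff : <<s @RGenCInfty.G R >> `<=` [set B | <<s Q >> (fst @^-1` B)].
    by apply.
  apply: smallest_sub.
    have := sigma_algebra_image (@fst R R) sQ.
    rewrite /image_set_system.
    by under eq_fun do rewrite setTI.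
  move=> _ [x ->] /=.
  have -> : fst @^-1` `[x, +oo[ = \bigcup_k quadrant x (- k%:R).
    apply/seteqP; split => -[a b].
      move=> ax; exists (Num.truncn `|b|).+1 => //; split => //=.
      have : `|b| < (Num.truncn `|b|).+1%:R by exact: truncnS_gt.
      by rewrite ltr_norml in_itv/= andbT => /andP[/ltW].
    by move=> [k _ []].
  apply: sigma_algebra_bigcup => k.
  by apply: sub_sigma_algebra; exists x, (- k%:R).
- suff : <<s @RGenCInfty.G R >> `<=` [set B | <<s Q >> (snd @^-1` B)].
    by apply.
  apply: smallest_sub.
    have := sigma_algebra_image (@snd R R) sQ.
    rewrite /image_set_system.
    by under eq_fun do rewrite setTI.
  move=> _ [y ->] /=.
  have -> : snd @^-1` `[y, +oo[ = \bigcup_k quadrant (- k%:R) y.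
    apply/seteqP; split => -[a b].
      move=> ax; exists (Num.truncn `|a|).+1 => //; split => //=.
      have : `|a| < (Num.truncn `|a|).+1%:R by exact: truncnS_gt.
      by rewrite ltr_norml in_itv/= andbT => /andP[/ltW].
    by move=> [k _ []].
  apply: sigma_algebra_bigcup => k.
  by apply: sub_sigma_algebra; exists (- k%:R), y.
Qed.

(** The positive and negative parts of [h] are the densities of two finite
    measures that agree on the pi-system of quadrants. *)
Lemma quadrant_Rintegral0_ae0 (h : R * R -> R) :
  leb2.-integrable setT (EFin \o h) ->
  (forall x y, Rintegral leb2 (quadrant x y) h = 0) ->
  {ae leb2, forall z, h z = 0}.
Proof.
move=> ih h0; have mh := measurable_int _ ih.
have iX (X : set plane) : measurable X -> leb2.-integrable X (EFin \o h).
  by move=> mX; exact: (integrableS measurableT mX _ ih).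
have posneg0 (X : set plane) : measurable X ->
    (\int[leb2]_(z in X) (h z)%:E = 0 <->
     density leb2 (EFin \o h)^\+ X = density leb2 (EFin \o h)^\- X)%E.
  move=> mX; rewrite integralE /density.
  move: (integrable_fin_num mX (integrable_funepos mX (iX _ mX))).
  move: (integrable_fin_num mX (integrable_funeneg mX (iX _ mX))).
  case: integral => // a _; case: integral => // b _.
  by split=> [[/eqP]|[->]]; rewrite ?subr_eq0 ?subee// => /eqP ->.
have E (X : set plane) : measurable X ->
    (density leb2 (EFin \o h)^\+ X = density leb2 (EFin \o h)^\- X)%E.
  apply: (measure_unique Q (fun k => quadrant (- k%:R) (- k%:R))) => //.
  - exact: measurable_quadrantsE.
  - move=> _ _ [x1 [y1 ->]] [x2 [y2 ->]]; rewrite quadrantI.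
    by do 2 eexists.
  - by move=> k; do 2 eexists.
  - exact: bigcup_quadrantN.
  - exact: measurable_funepos.
  - exact: measurable_funeneg.
  - move=> mp mn _ [x [y ->]].
    apply/(posneg0 _ (measurable_quadrant x y)).
    rewrite -[LHS]fineK; last first.
      exact: (integrable_fin_num (measurable_quadrant _ _) (iX _ (measurable_quadrant x y))).
    by congr _%:E; exact: h0.
  - move=> mp k; rewrite ltey_eq; apply/orP; left.
    exact: (integrable_fin_num (measurable_quadrant _ _)
      (integrable_funepos (measurable_quadrant _ _)
        (iX _ (measurable_quadrant _ _)))).
have : ae_eq leb2 setT (EFin \o h) (cst 0%E).
  apply: integral_ae_eq => // X _ mX.
  by rewrite integral0; apply/(posneg0 _ mX)/E.
by apply: filterS => z /(_ I) /= [].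
Qed.

End Quadrants.

(** * The antiderivative is the integral over a quadrant *)

Lemma scale_lincomb (R : realType) (V : lmodType R) (u v : V) (x y n a b t : R) :
  x *: u + y *: v + t *: (n *: (b *: v + a *: u)) =
  (x + a * n * t) *: u + (y + b * n * t) *: v.
Proof.
rewrite scalerA scalerDr !scalerDl !scalerA [_ + (_ *: u)]addrC addrACA.
by congr (_ + _ *: _ + (_ + _ *: _)); ring.
Qed.

Section Cones.
Context {R : realType}.
Notation plane := (measurableTypeR R * measurableTypeR R)%type.
Implicit Types (h : R * R -> R).

(** Removing one of the two edges of a quadrant does not change the integral.
    Opening the appropriate edge lets the two cones below fit together as sets,
    without common points. *)
Lemma Rintegral_quadrant_openl h : leb2.-integrable setT (EFin \o h) ->
  Rintegral leb2 (`]0, +oo[ `*` `[0, +oo[) h = Rintegral leb2 (quadrant 0 0) h.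
Proof.
move=> ih.
have mo : measurable (`]0, +oo[%classic : set (measurableTypeR R)).
  exact: measurable_itv.
have mc : measurable (`[0, +oo[%classic : set (measurableTypeR R)).
  exact: measurable_itv.
have [io Eo] := Rintegral_setX mo mc ih.
have [_ Ec] := Rintegral_setX mc mc ih.
by rewrite -Eo -Ec; exact: Rintegral_itv_obnd_cbnd.
Qed.

Lemma Rintegral_quadrant_openr h : leb2.-integrable setT (EFin \o h) ->
  Rintegral leb2 (`[0, +oo[ `*` `]0, +oo[) h = Rintegral leb2 (quadrant 0 0) h.
Proof.
move=> ih.
have mo : measurable (`]0, +oo[%classic : set (measurableTypeR R)).
  exact: measurable_itv.
have mc : measurable (`[0, +oo[%classic : set (measurableTypeR R)).
  exact: measurable_itv.
have [_ Eo] := Rintegral_setX mc mo ih.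
have [_ Ec] := Rintegral_setX mc mc ih.
rewrite -Eo -Ec; apply: eq_Rintegral => x _.
rewrite /Rintegral; congr fine; apply: integral_itv_obnd_cbnd.
apply: measurable_funTS.
exact: (measurable_fun_pair2 x (measurable_int _ ih)).
Qed.

End Cones.

Section Antiderivative.
Context {R : realType}.
Notation plane := (measurableTypeR R * measurableTypeR R)%type.
Variables (u v : R * R) (cu cv : R) (f : R * R -> R) (x0 y0 : R).
Hypotheses (cu_neq0 : cu != 0) (cv_gt0 : 0 < cv).
Let N := enorm (cu *: v + cv *: u).
Hypothesis N_gt0 : 0 < N.
Let g (z : R * R) := f (z.1 *: u + z.2 *: v).
Hypothesis ig : leb2.-integrable setT (EFin \o g).

(* In coordinates with respect to [(u, v)]: [Tv (t, s)] and [Tu (t, s)] are the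
   points reached from [(x0, y0)] by moving by [t] along [alpha_tilde] and then
   by [s] along [v], resp. [u]. [Iv] and [Iu] are their inverses. *)
Let Tv (z : R * R) : R * R :=
  (x0 + cv / N * z.1 + 0 * z.2, y0 + cu / N * z.1 + 1 * z.2).
Let Tu (z : R * R) : R * R :=
  (x0 + cv / N * z.1 + 1 * z.2, y0 + cu / N * z.1 + 0 * z.2).
Let Iv (z : R * R) : R * R :=
  ((z.1 - x0) * (N / cv), (z.2 - y0) - cu / cv * (z.1 - x0)).
Let Iu (z : R * R) : R * R :=
  ((z.2 - y0) * (N / cu), (z.1 - x0) - cv / cu * (z.2 - y0)).

Let N0 : N != 0. Proof. by rewrite gt_eqF. Qed.
Let cv0 : cv != 0. Proof. by rewrite gt_eqF. Qed.

Let TvK : cancel Tv Iv.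
Proof. by move=> [t s]; rewrite /Tv /Iv/=; congr pair; field; rewrite ?N0 ?cv0 ?cu_neq0. Qed.

Let TuK : cancel Tu Iu.
Proof. by move=> [t s]; rewrite /Tu /Iu/=; congr pair; field; rewrite ?N0 ?cv0 ?cu_neq0. Qed.

Let sTv : scales_area Tv (N / cv).
Proof.
have D0 : cv / N * 1 - 0 * (cu / N) != 0.
  by rewrite mulr1 mul0r subr0 mulf_neq0// invr_neq0.
have := scales_area_affine x0 y0 D0; congr scales_area.
by rewrite mulr1 mul0r subr0 gtr0_norm ?divr_gt0// invf_div.
Qed.

Let sTu : scales_area Tu (N / `|cu|).
Proof.
have D0 : cv / N * 0 - 1 * (cu / N) != 0.
  by rewrite mulr0 mul1r sub0r oppr_eq0 mulf_neq0// invr_neq0.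
have := scales_area_affine x0 y0 D0; congr scales_area.
rewrite mulr0 mul1r sub0r normrN normrM invfM normfV invrK mulrC.
by rewrite (gtr0_norm N_gt0).
Qed.

Let mIv (D : set plane) : measurable D -> measurable (Iv @^-1` D : set plane).
Proof.
move=> mD; rewrite -[X in measurable X]setTI.
suff mI : measurable_fun setT (Iv : plane -> plane) by exact: mI.
apply: measurable_fun_pair.
  by apply: measurable_funM => //; apply: measurable_funB.
apply: measurable_funB; first by apply: measurable_funB.
by apply: measurable_funM => //; apply: measurable_funB.
Qed.

Let mIu (D : set plane) : measurable D -> measurable (Iu @^-1` D : set plane).
Proof.
move=> mD; rewrite -[X in measurable X]setTI.
suff mI : measurable_fun setT (Iu : plane -> plane) by exact: mI.
apply: measurable_fun_pair.
  by apply: measurable_funM => //; apply: measurable_funB.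
apply: measurable_funB; first by apply: measurable_funB.
by apply: measurable_funM => //; apply: measurable_funB.
Qed.

Let Rintegral_Tv (D : set plane) : measurable D ->
  Rintegral leb2 D (g \o Tv) = N / cv * Rintegral leb2 (Iv @^-1` D) g.
Proof.
move=> mD; rewrite -(scales_area_Rintegral sTv _ ig); last exact: mIv.
by rewrite -comp_preimage (_ : Iv \o Tv = id)//; apply/funext => z; exact: TvK.
Qed.

Let Rintegral_Tu (D : set plane) : measurable D ->
  Rintegral leb2 D (g \o Tu) = N / `|cu| * Rintegral leb2 (Iu @^-1` D) g.
Proof.
move=> mD; rewrite -(scales_area_Rintegral sTu _ ig); last exact: mIu.
by rewrite -comp_preimage (_ : Iu \o Tu = id)//; apply/funext => z; exact: TuK.
Qed.

Let igv : leb2.-integrable setT (EFin \o (g \o Tv)).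
Proof. by have := scales_area_integrable sTv measurableT ig. Qed.

Let igu : leb2.-integrable setT (EFin \o (g \o Tu)).
Proof. by have := scales_area_integrable sTu measurableT ig. Qed.

Let iterated :
  ray_integral (alpha_tilde cu cv u v) (vline_transform cu cv u v f)
    (x0 *: u + y0 *: v) =
  cv * Rintegral leb2 (quadrant 0 0) (g \o Tv) +
  cu * Rintegral leb2 (quadrant 0 0) (g \o Tu).
Proof.
have mc : measurable (`[0, +oo[%classic : set (measurableTypeR R)).
  exact: measurable_itv.
have [iV EV] := Rintegral_setX mc mc igv.
have [iU EU] := Rintegral_setX mc mc igu.
rewrite -[quadrant 0 0]/(`[0, +oo[ `*` `[0, +oo[) -EV -EU.
rewrite -(RintegralZl cv mc iV) -(RintegralZl cu mc iU).
rewrite -[RHS](RintegralD mc (integrableZl mc cv iV) (integrableZl mc cu iU)).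
apply: eq_Rintegral => t _; rewrite /vline_transform.
have pt w : x0 *: u + y0 *: v + t *: alpha_tilde cu cv u v + w =
    (x0 + cv / N * t) *: u + (y0 + cu / N * t) *: v + w.
  by rewrite /alpha_tilde -/N scale_lincomb.
have -> : ray_integral v f (x0 *: u + y0 *: v + t *: alpha_tilde cu cv u v) =
    \int[lebesgue_measure]_(s in `[0, +oo[) (g \o Tv) (t, s).
  apply: eq_Rintegral => s _; rewrite pt /g /Tv /= mul0r mul1r addr0.
  by rewrite [(_ + s) *: v]scalerDl addrA.
have -> : ray_integral u f (x0 *: u + y0 *: v + t *: alpha_tilde cu cv u v) =
    \int[lebesgue_measure]_(s in `[0, +oo[) (g \o Tu) (t, s).
  apply: eq_Rintegral => s _; rewrite pt /g /Tu /= mul0r mul1r addr0.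
  by rewrite [(_ + s) *: u]scalerDl addrAC.
by [].
Qed.

Let quadrant_cones : cv * Rintegral leb2 (quadrant 0 0) (g \o Tv) +
  cu * Rintegral leb2 (quadrant 0 0) (g \o Tu) =
  N * Rintegral leb2 (quadrant x0 y0) g.
Proof.
have iX (X : set plane) : measurable X -> leb2.-integrable X (EFin \o g).
  by move=> mX; exact: (integrableS measurableT mX _ ig).
have mo : measurable (`]0, +oo[%classic : set (measurableTypeR R)).
  exact: measurable_itv.
have mc : measurable (`[0, +oo[%classic : set (measurableTypeR R)).
  exact: measurable_itv.
have mA : measurable (Iv @^-1` quadrant 0 0 : set plane).
  apply: mIv; exact: measurable_quadrant.
have NV := divr_gt0 N_gt0 cv_gt0.
rewrite Rintegral_Tv; last exact: measurable_quadrant.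
have inQ x y : quadrant x0 y0 (x, y) <-> x0 <= x /\ y0 <= y.
  by rewrite /quadrant/= !in_itv/= !andbT.
have inV x y : (Iv @^-1` quadrant 0 0) (x, y) <->
    x0 <= x /\ cu * (x - x0) <= cv * (y - y0).
  rewrite /Iv /quadrant/= !in_itv/= !andbT pmulr_lge0// !subr_ge0.
  by rewrite mulrAC ler_pdivrMr// [_ * cv]mulrC.
rewrite mulrA (_ : cv * (N / cv) = N); last by field.
(* The line through [(x0, y0)] along [alpha_tilde] has the equation
   [cu * (x - x0) = cv * (y - y0)]. *)
have [cup|cun] : 0 < cu \/ cu < 0.
  by move: cu_neq0; rewrite neq_lt => /orP[]; tauto.
(* The ray along [alpha_tilde] cuts the quadrant in two; it is attributed to the
   cone on the side of [v]. *)
- have inU x y : (Iu @^-1` (`[0, +oo[ `*` `]0, +oo[)) (x, y) <->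
      y0 <= y /\ cv * (y - y0) < cu * (x - x0).
    rewrite /Iu/= !in_itv/= !andbT pmulr_lge0 ?divr_gt0// subr_ge0 subr_gt0.
    by rewrite mulrAC ltr_pdivrMr// [_ * cu]mulrC.
  rewrite -Rintegral_quadrant_openr// Rintegral_Tu; last exact: measurableX.
  have mB : measurable (Iu @^-1` (`[0, +oo[ `*` `]0, +oo[) : set plane).
    by apply: mIu; exact: measurableX.
  rewrite (gtr0_norm cup) [cu * _]mulrA (_ : cu * (N / cu) = N); last by field.
  rewrite -mulrDr; congr (_ * _).
  rewrite -Rintegral_setU//; last 2 first.
  - exact/iX/measurableU.
  - apply/disj_setPS => -[x y] [/inV[_ le1] /inU[_]].
    by rewrite ltNge le1.
  congr Rintegral; apply/seteqP; split => -[x y].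
    case=> [/inV[Xge le1]|/inU[Yge lt1]]; apply/inQ; split => //.
      rewrite -subr_ge0 -(pmulr_rge0 _ cv_gt0) (le_trans _ le1)//.
      by rewrite mulr_ge0 ?subr_ge0// ltW.
    rewrite -subr_ge0 -(pmulr_rge0 _ cup) (le_trans _ (ltW lt1))//.
    by rewrite mulr_ge0 ?subr_ge0// ltW.
  move=> /inQ[? ?].
  have [?|?] := leP (cu * (x - x0)) (cv * (y - y0)).
    by left; apply/inV.
  by right; apply/inU.
(* The cone of [alpha_tilde] and [v] is the disjoint union of the quadrant and
   of the cone of [alpha_tilde] and [u] without its edge along [u]. *)
- have inU x y : (Iu @^-1` (`]0, +oo[ `*` `[0, +oo[)) (x, y) <->
      y < y0 /\ cu * (x - x0) <= cv * (y - y0).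
    rewrite /Iu/= !in_itv/= !andbT nmulr_lgt0; last by rewrite pmulr_rlt0// invr_lt0.
    by rewrite subr_lt0 subr_ge0 mulrAC ler_ndivrMr// [_ * cu]mulrC.
  rewrite -Rintegral_quadrant_openl// Rintegral_Tu; last exact: measurableX.
  have mB : measurable (Iu @^-1` (`]0, +oo[ `*` `[0, +oo[) : set plane).
    by apply: mIu; exact: measurableX.
  rewrite (ltr0_norm cun) [cu * _]mulrA (_ : cu * (N / - cu) = - N); last first.
    by field.
  rewrite mulNr -mulrBr; congr (_ * _).
  have -> : Iv @^-1` quadrant 0 0 =
      quadrant x0 y0 `|` Iu @^-1` (`]0, +oo[ `*` `[0, +oo[).
    apply/seteqP; split => -[x y].
      move=> /inV[? ?]; have [?|?] := ltP y y0; first by right; apply/inU.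
      by left; apply/inQ.
    case=> [/inQ[Xge Yge]|/inU[Ylt le1]]; apply/inV; split => //.
      apply: (@le_trans _ _ 0).
        by rewrite nmulr_rle0// subr_ge0.
      by rewrite mulr_ge0 ?subr_ge0// ltW.
    rewrite -subr_ge0 -(nmulr_rle0 _ cun) (le_trans le1)//.
    by rewrite pmulr_rle0// subr_le0 ltW.
  rewrite Rintegral_setU ?addrK//.
  - exact: measurable_quadrant.
  - by apply/iX/measurableU => //; exact: measurable_quadrant.
  - apply/disj_setPS => -[x y] [/inQ[_ y0y] /inU[]].
    by rewrite ltNge y0y.
Qed.

(** The factors [N / cv] and [N / |cu|] given by the two changes of variables
    turn the weights [cv] and [cu] into [N] and [N] times the sign of [cu]; the
    signed sum of the two cones is then the quadrant. *)
Lemma vline_antiderivativeE beta1 :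
  vline_antiderivative cu cv beta1 u v f (x0 *: u + y0 *: v) =
  sin beta1 / cv * (N * Rintegral leb2 (quadrant x0 y0) g).
Proof. by rewrite /vline_antiderivative iterated quadrant_cones. Qed.

End Antiderivative.

(** * From constant quadrant integrals to a null function *)

Section Boxes.
Context {R : realType}.
Notation plane := (measurableTypeR R * measurableTypeR R)%type.
Variable g : R * R -> R.
Hypothesis ig : leb2.-integrable setT (EFin \o g).

Let mI (i : interval R) : measurable ([set` i] : set (measurableTypeR R)).
Proof. exact: measurable_itv. Qed.

Let ray_setU (a b : R) : a <= b -> `[a, +oo[%classic = `[a, b[ `|` `[b, +oo[.
Proof. by move=> ab; apply: itv_bndbnd_setU; rewrite ?bnd_simp. Qed.

Let ray_disj (a b : R) : [disjoint `[a, b[%classic & `[b, +oo[%classic].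
Proof.
apply/disj_setPS => x [/=]; rewrite !in_itv/= andbT => /andP[_ xb].
by rewrite leNgt xb.
Qed.

Let RintegralX_setUl (A B Y : set (measurableTypeR R)) :
  measurable A -> measurable B -> measurable Y -> [disjoint A & B] ->
  Rintegral leb2 ((A `|` B) `*` Y) g =
  Rintegral leb2 (A `*` Y) g + Rintegral leb2 (B `*` Y) g.
Proof.
move=> mA mB mY /disj_setPS AB.
have mAY : measurable (A `*` Y) by exact: measurableX.
have mBY : measurable (B `*` Y) by exact: measurableX.
have -> : (A `|` B) `*` Y = (A `*` Y) `|` (B `*` Y).
  by apply/seteqP; split=> [[x y] [[] ? ?]|[x y] [] [? ?]];
    [left|right|split => //; left|split => //; right].
apply: Rintegral_setU => //.
- exact: (integrableS measurableT (measurableU _ _ mAY mBY) _ ig).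
- by apply/disj_setPS => -[x y] [[? _] [? _]]; apply: (AB x).
Qed.

Let RintegralX_setUr (A B X : set (measurableTypeR R)) :
  measurable A -> measurable B -> measurable X -> [disjoint A & B] ->
  Rintegral leb2 (X `*` (A `|` B)) g =
  Rintegral leb2 (X `*` A) g + Rintegral leb2 (X `*` B) g.
Proof.
move=> mA mB mX /disj_setPS AB.
have mXA : measurable (X `*` A) by exact: measurableX.
have mXB : measurable (X `*` B) by exact: measurableX.
have -> : X `*` (A `|` B) = (X `*` A) `|` (X `*` B).
  by apply/seteqP; split=> [[x y] [? []]|[x y] [] [? ?]];
    [left|right|split => //; left|split => //; right].
apply: Rintegral_setU => //.
- exact: (integrableS measurableT (measurableU _ _ mXA mXB) _ ig).
- by apply/disj_setPS => -[x y] [[_ ?] [_ ?]]; apply: (AB y).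
Qed.

Lemma Rintegral_box (a b c d : R) : a <= b -> c <= d ->
  Rintegral leb2 (`[a, b[ `*` `[c, d[) g =
  Rintegral leb2 (quadrant a c) g - Rintegral leb2 (quadrant b c) g -
  (Rintegral leb2 (quadrant a d) g - Rintegral leb2 (quadrant b d) g).
Proof.
move=> ab cd; rewrite /quadrant (ray_setU ab) !RintegralX_setUl// !addrK.
by rewrite (ray_setU cd) RintegralX_setUr// addrK.
Qed.

(** The integral of the cut-off of [g] over a quadrant is the integral of [g]
    over a smaller box with corners in the closed box, where the alternating
    sum of corner values is [K - K - (K - K)]. *)
Lemma quadrant_Rintegral_cst_ae0 (a b c d K : R) : a <= b -> c <= d ->
  (forall x y, a <= x <= b -> c <= y <= d ->
    Rintegral leb2 (quadrant x y) g = K) ->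
  {ae leb2, forall z, (`[a, b[ `*` `[c, d[) z -> g z = 0}.
Proof.
move=> ab cd gK.
set B := `[a, b[ `*` `[c, d[.
have mB : measurable (B : set plane) by exact: measurableX.
have : {ae leb2, forall z, (g \_ B) z = 0}.
  apply: quadrant_Rintegral0_ae0.
    rewrite -restrict_EFin; apply/(integrable_mkcond _ mB).
    exact: (integrableS measurableT mB _ ig).
  move=> x y; rewrite -Rintegral_mkcondr.
  (* Truncating at [b] and [d] makes the smaller box empty, instead of
     ill-formed, when the quadrant misses the box. *)
  set x' := Num.min b (Num.max a x); set y' := Num.min d (Num.max c y).
  have x'P : a <= x' <= b by rewrite le_min ab le_max lexx ge_min lexx.
  have y'P : c <= y' <= d by rewrite le_min cd le_max lexx ge_min lexx.
  have -> : quadrant x y `&` B = `[x', b[ `*` `[y', d[.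
    apply/seteqP; split => -[s t]; rewrite /quadrant /B/= !in_itv/= !andbT.
      move=> [[xs yt] [/andP[as_ sb] /andP[ct td]]].
      by rewrite sb td !andbT !ge_min !ge_max xs yt as_ ct !orbT.
    move=> [/andP[+ sb] /andP[+ td]]; rewrite sb td !ge_min !ge_max.
    by rewrite !leNgt sb td/= -!leNgt => /andP[-> ->] /andP[-> ->].
  have [/andP[_ x'b] /andP[_ y'd]] := (x'P, y'P).
  rewrite Rintegral_box// !gK ?subrr// ?lexx ?ab ?cd//.
apply: negligibleS => z /= /not_implyP[Bz gz].
by rewrite patchE mem_set.
Qed.

End Boxes.

Lemma scales_area_ae (R : realType) (T : R * R -> R * R) (c : R)
    (P : R * R -> Prop) : scales_area T c ->
  {ae leb2, forall z, P z} -> {ae leb2, forall z, P (T z)}.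
Proof.
move=> [c0 mT sT] [A [mA A0 PA]]; exists (T @^-1` A); split.
- by rewrite -[X in measurable X]setTI; exact: mT.
- by rewrite sT// A0 mule0.
- by move=> z /= /PA.
Qed.

(** A property that holds almost everywhere on each box holds almost everywhere
    on the interior, which is covered by countably many boxes with rational
    corners. Boxes are half-open in the conclusion of the hypothesis, as their
    integrals are differences of quadrant integrals, but [W] must contain their
    closure, where the corners lie. *)
Lemma ae_box_cover (R : realType) (W : set (R * R)) (P : R * R -> Prop) :
  (forall a b c d : R, a <= b -> c <= d -> `[a, b] `*` `[c, d] `<=` W ->
    {ae leb2, forall z, (`[a, b[ `*` `[c, d[) z -> P z}) ->
  {ae leb2, forall z, interior W z -> P z}.
Proof.
move=> boxP.
pose box (q : rat * rat * rat * rat) : set (R * R) :=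
  `[ratr q.1.1.1, ratr q.1.1.2[ `*` `[ratr q.1.2, ratr q.2[.
pose cbox (q : rat * rat * rat * rat) : set (R * R) :=
  `[ratr q.1.1.1, ratr q.1.1.2] `*` `[ratr q.1.2, ratr q.2].
pose bad q := [set z | [/\ (ratr q.1.1.1 : R) <= ratr q.1.1.2,
  (ratr q.1.2 : R) <= ratr q.2, cbox q `<=` W, box q z & ~ P z]].
have bad0 q : leb2.-negligible (bad q).
  have [[le1 le2 qW]|nq] := pselect [/\ (ratr q.1.1.1 : R) <= ratr q.1.1.2,
      (ratr q.1.2 : R) <= ratr q.2 & cbox q `<=` W].
    apply: negligibleS (boxP _ _ _ _ le1 le2 qW).
    by move=> z [_ _ _ qz Pz] /(_ qz).
  rewrite (_ : bad q = set0); first exact: negligible_set0.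
  by apply/seteqP; split => // z [? ? ? _ _]; apply: nq.
pose F n := if unpickle n is Some q then bad q else set0.
have F0 n : leb2.-negligible (F n).
  by rewrite /F; case: unpickle => // *; exact: negligible_set0.
apply: negligibleS (negligible_bigcup F0) => -[x y] /= /not_implyP[].
move=> /nbhs_ballP[e /= e0 eW] Pz.
have ratl (t : R) : exists q : rat, t - e < ratr q < t.
  have [|q] := @rat_in_itvoo R (t - e) t; first by rewrite gtrDl oppr_lt0.
  by rewrite in_itv/=; exists q.
have ratg (t : R) : exists q : rat, t < ratr q < t + e.
  have [|q] := @rat_in_itvoo R t (t + e); first by rewrite ltrDl.
  by rewrite in_itv/=; exists q.
have [a /andP[xa ax]] := ratl x; have [b /andP[xb bx]] := ratg x.
have [c /andP[yc cy]] := ratl y; have [d /andP[yd dy]] := ratg y.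
suff bad_z : bad (a, b, c, d) (x, y).
  by exists (pickle (a, b, c, d)); [exact: I|rewrite /F pickleK].
split; last exact: Pz.
- by rewrite ltW// (lt_trans ax).
- by rewrite ltW// (lt_trans cy).
- move=> [s t] []; rewrite /= !in_itv/= => /andP[s1 s2] /andP[t1 t2].
  apply: eW; split => /=; rewrite /ball/= ltr_distlC.
    by rewrite (lt_le_trans xa)//= (le_lt_trans s2).
  by rewrite (lt_le_trans yc)//= (le_lt_trans t2).
- by split; rewrite /= in_itv/= ?(ltW ax) ?(ltW cy).
Qed.

(** * Conclusion *)

Lemma free2_det_neq0 (R : realType) (u v : R * R) :
  free [:: u : R^o * R^o; v] -> u.1 * v.2 - v.1 * u.2 != 0.
Proof.
rewrite free_cons seq1_free span_seq1 => /andP[uv v0].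
apply: contra uv; rewrite subr_eq0 => /eqP uv; apply/vlineP.
case: u v v0 uv => [u1 u2] [v1 v2] v0 /= uv.
have [v10|v10] := eqVneq v1 0.
  have v20 : v2 != 0.
    by apply: contraNneq v0 => v20; rewrite v10 v20; apply/eqP.
  have u10 : u1 = 0.
    by move: uv; rewrite v10 mul0r => /eqP; rewrite mulf_eq0 (negbTE v20) orbF
      => /eqP.
  exists (u2 / v2); apply: injective_projections => /=.
    by rewrite u10 v10; exact/esym/mulr0.
  exact/esym/divfK.
exists (u1 / v1); apply: injective_projections => /=.
  exact/esym/divfK.
transitivity (u1 / v1 * v2) => //.
by rewrite mulrAC uv mulrAC divff// mul1r.
Qed.

Lemma enorm_lincomb_gt0 (R : realType) (u v : R * R) (cu cv : R) :
  u.1 * v.2 - v.1 * u.2 != 0 -> cv != 0 -> 0 < enorm (cu *: v + cv *: u).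
Proof.
move=> D0 cv0; rewrite /enorm /dot.
set w1 := (cu *: v + cv *: u).1; set w2 := (cu *: v + cv *: u).2.
have w1E : w1 = cu * v.1 + cv * u.1 by [].
have w2E : w2 = cu * v.2 + cv * u.2 by [].
rewrite sqrtr_gt0 lt0r -!expr2 addr_ge0 ?sqr_ge0// andbT.
rewrite paddr_eq0 ?sqr_ge0// !sqrf_eq0.
apply: contra (mulf_neq0 cv0 D0) => /andP[/eqP w10 /eqP w20]; apply/eqP.
transitivity (w1 * v.2 - w2 * v.1); first by rewrite w1E w2E; ring.
by rewrite w10 w20 !mul0r subrr.
Qed.

Lemma continuous_lincomb (R : realType) (u v : R * R) :
  continuous (fun z : R * R => z.1 *: u + z.2 *: v).
Proof.
move=> z; apply: cvgD; apply: cvgZr_tmp; [exact: cvg_fst|exact: cvg_snd].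
Qed.

Unset Implicit Arguments.
Set Strict Implicit.

Theorem theorem13 (R : realType) (u v : R * R) (beta beta1 beta2 cu cv : R)
    (f : R * R -> R) (S : set (R * R))
    (u_unit : enorm u = 1) (v_unit : enorm v = 1)
    (uv_free : free [:: u : R^o * R^o; v])
    (beta_bounds : 0 < 2 * beta < pi) (uv_angle : angle u v = 2 * beta)
    (cu_neq0 : cu != 0) (cv_gt0 : 0 < cv)
    (beta1_bounds : 0 < beta1 < pi) (beta2_bounds : 0 < `|beta2| < pi)
    (beta12_sum : beta1 + beta2 = 2 * beta)
    (beta12_ratio : sin beta1 / sin beta2 = cv / cu)
    (f_L1 : f \in Lfun leb2 1%E)
    (S_interior : interior S !=set0)
    (F_const : exists c : R, forall p, S p ->
       vline_antiderivative cu cv beta1 u v f p = c) :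
  {ae leb2, forall p, interior S p -> f p = 0}.
Proof.
have D0 := free2_det_neq0 uv_free.
set D := u.1 * v.2 - v.1 * u.2 in D0.
have N_gt0 := enorm_lincomb_gt0 cu D0 (lt0r_neq0 cv_gt0).
pose L (z : R * R) : R * R := z.1 *: u + z.2 *: v.
pose L' (p : R * R) : R * R :=
  (0 + v.2 / D * p.1 + (- v.1 / D) * p.2, 0 + (- u.2 / D) * p.1 + u.1 / D * p.2).
have LL' : cancel L' L.
  by move=> p; apply: injective_projections;
    rewrite /L /L' !add0r /= /GRing.scale/= /D; field.
have sL : scales_area L `|D|^-1.
  have := scales_area_affine 0 0 D0; congr scales_area.
  apply/funext => z; apply: injective_projections;
    by rewrite /L/= add0r /GRing.scale/= ![_ * z.1]mulrC ![_ * z.2]mulrC.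
have D0' : v.2 / D * (u.1 / D) - (- v.1 / D) * (- u.2 / D) != 0.
  rewrite (_ : _ - _ = D^-1) ?invr_eq0//.
  by rewrite /D; field.
(* Null sets are transported from the coordinates of [g] to those of [f] by
   taking preimages under the inverse map [L']. *)
have sL' := scales_area_affine 0 0 D0'.
pose g := f \o L.
have ig : leb2.-integrable setT (EFin \o g).
  have /Lfun1_integrable jf := f_L1.
  by have := scales_area_integrable sL measurableT jf.
have [c Fc] := F_const.
(* [k] is nonzero because [beta1] lies in the open interval from 0 to pi. *)
pose k := sin beta1 / cv * enorm (cu *: v + cv *: u).
have k0 : k != 0.
  rewrite mulf_neq0 ?gt_eqF// divr_gt0//.
  exact: sin_gt0_pi.
have Qc x y : S (L (x, y)) -> Rintegral leb2 (quadrant x y) g = c / k.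
  move=> /Fc <-; rewrite (vline_antiderivativeE x y cu_neq0 cv_gt0 N_gt0 ig).
  by rewrite mulrA -/k mulrC mulKf.
have g0 : {ae leb2, forall z, interior (L @^-1` S) z -> g z = 0}.
  apply: ae_box_cover => a1 b1 a2 b2 ab1 ab2 boxS.
  apply: (quadrant_Rintegral_cst_ae0 ig (K := c / k)) => // x y xP yP.
  by apply/Qc/boxS; split; rewrite /= in_itv.
apply: negligibleS (scales_area_ae sL' g0) => p /= /not_implyP[Sp fp] g0p.
apply: fp; rewrite -(LL' p); apply: g0p.
have nS : nbhs (L (L' p)) S by rewrite LL'.
exact: (continuous_lincomb nS).
Qed.
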